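(* Let $v^*=[C^*;w^*]\in\mathbb{R}^{1+Tn}$ with Lagrange multipliers $\lambda^*\in\mathbb{R}$, $\mu^*\in\mathbb{R}^{Tn}$ satisfy the KKT conditions (see context) of $$\min_{C\in\mathbb{R},\,w\in\mathbb{R}^{Tn}}\ \frac{1}{Tm_1}f(w)\quad\text{s.t.}\quad C\ge 0,\quad w+C\,g(w)=\mathbf{0}. \qquad(\mathrm{NLP})$$ If one of the following three conditions holds, then $v^*$ is a strict local minimizer of (NLP): (i) $C^*>0$ and $z(\mu^*,v^* )>0$; (ii) $C^*=0$, $\lambda^*=0$ and $\iota(\mu^* )>0$; (iii) $C^*=0$ and $\lambda^*>0$.
   Context: Let $T,m_1,m_2,n$ be positive integers. For $j\in\{1,\dots,T\}$ let $\bar x_i^{(j)}\in\mathbb{R}^n$, $\bar y_i^{(j)}\in\{\pm1\}$ ($1\le i\le m_1$) be validation data and $\hat x_i^{(j)}\in\mathbb{R}^n$, $\hat y_i^{(j)}\in\{\pm1\}$ ($1\le i\le m_2$) be training data. Let $A\in\mathbb{R}^{Tm_1\times Tn}$ be block diagonal with diagonal blocks $A^{(1)},\dots,A^{(T)}$, where $A^{(j)}\in\mathbb{R}^{m_1\times n}$ has rows $A^{(j)}_i=(\bar y_i^{(j)}\bar x_i^{(j)})^\top$. Let $X\in\mathbb{R}^{Tn\times Tm_2}$ be block diagonal with diagonal blocks $X^{(j)}=[\hat x_1^{(j)},\dots,\hat x_{m_2}^{(j)}]\in\mathbb{R}^{n\times m_2}$, and let $\hat y\in\mathbb{R}^{Tm_2}$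 be the stacked vector of the labels $\hat y_i^{(j)}$. Exponentials and logarithms of vectors are componentwise. Define $f(w):=\mathbf{1}^\top\log(\mathbf{1}+e^{-Aw})$; $h_X(w)\in\mathbb{R}^{Tm_2}$ is obtained by applying $\theta\mapsto\frac{1-e^{-\theta}}{1+e^{-\theta}}$ to each component of $X^\top w$; $g(w):=\frac12X(h_X(w)-\hat y)\in\mathbb{R}^{Tn}$. Let $u(w),q(w)\in\mathbb{R}^{Tm_2}$ be obtained by applying, respectively, $\theta\mapsto(2+e^{-\theta}+e^{\theta})^{-1}$ and $\theta\mapsto\frac{e^{-\theta}(e^{-\theta}-1)}{(1+e^{-\theta})^3}$ to each component of $X^\top w$, and let $p(w)\in\mathbb{R}^{Tm_1}$ be obtained by applying $\theta\mapsto\frac{e^{\theta}}{(1+e^{\theta})^2}$ to each component of $Aw$. The Jacobian of $g$ is $\nabla g(w)=X\,\mathrm{Diag}(u(w))X^\top$ (symmetric). For $v=[C;w]$ put $P(v):=I_{Tn}+C\,\nabla g(w)$, which is positive definite for every $C\ge 0$. KKT conditions for $(C,w,\lambda,\mu)$: $-\lambda+\mu^\top g(w)=0$; $\frac1{Tm_1}\nabla f(w)+P(v)\mu=\mathbf{0}$; $\lambda\ge0$, $C\ge0$, $\lambda C=0$; $w+C\,g(w)=\mathbf{0}$. Further define $$\alpha(\mu,v):=\tfrac1{Tm_1}A^\top\mathrm{Diag}(p(w))A+C\,X\,\mathrm{Diag}(X^\top\mu)\,\mathrm{Diag}(q(w))X^\top\in\mathbb{R}^{Tn\times Tn},$$ $$z(\mu,v):=g(w)^\top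 P(v)^{-1}\left(\alpha(\mu,v)P(v)^{-1}g(w)-2\nabla g(w)\mu\right)\in\mathbb{R},$$ $$\iota(\mu):=\tfrac14\mu^\top XX^\top X\hat y+\tfrac1{16Tm_1}(X\hat y)^\top A^\top A X\hat y\in\mathbb{R}.$$ *)

(* Defs.v *)
From HB Require Import structures.
From mathcomp Require Import all_boot all_order all_algebra.
From mathcomp Require Import all_classical all_reals all_analysis.
From mathcomp Require Import ring lra.

Set Implicit Arguments.
Unset Strict Implicit.
Unset Printing Implicit Defensive.
Import Order.TTheory GRing.Theory Num.Theory.
Import numFieldNormedType.Exports.
Local Open Scope classical_set_scope.
Local Open Scope ring_scope.

Section Calculus.
Context {R : realType}.

Definition gradient d (F : 'cV[R]_d -> R) (w : 'cV[R]_d) : 'cV[R]_d :=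
  \col_k 'D_(delta_mx k 0) F w.

(* The library's [jacobian] is for maps between row vectors and acts on the
   right; this is the usual matrix of partial derivatives, row i being the
   gradient of the i-th component. *)
Definition jacobian_cV d e (F : 'cV[R]_d -> 'cV[R]_e) (w : 'cV[R]_d) :
    'M[R]_(e, d) :=
  \matrix_(i, k) 'D_(delta_mx k 0) (fun x => F x i 0) w.

Definition strict_local_minimizer (V : topologicalType) (feasible : set V)
    (obj : V -> R) (v0 : V) : Prop :=
  feasible v0 /\
  \forall v \near v0, feasible v -> v <> v0 -> obj v0 < obj v.

End Calculus.

Section Blocks.
Context {R : realType}.

Fact sum_ord_const T n : (\sum_(j < T) n = T * n)%N.
Proof. by rewrite sum_nat_const card_ord. Qed.

(* [\mxblock] and [\mxcol] have dimensions of the form \sum_(j < T) n, which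
   is equal, but not convertible, to T * n: hence the casts. *)
Definition blockdiag T m n (B : 'I_T -> 'M[R]_(m, n)) : 'M[R]_(T * m, T * n) :=
  castmx (sum_ord_const T m, sum_ord_const T n)
    (\mxblock_(j < T, k < T) (if j == k then B j else 0)).

Definition stack T m (b : 'I_T -> 'cV[R]_m) : 'cV[R]_(T * m) :=
  castmx (sum_ord_const T m, erefl 1%N) (\mxcol_(j < T) b j).

Definition val_mx T m1 n (xbar : 'I_T -> 'I_m1 -> 'cV[R]_n)
    (ybar : 'I_T -> 'I_m1 -> R) : 'M[R]_(T * m1, T * n) :=
  blockdiag (fun j => \matrix_(i < m1) (ybar j i *: xbar j i)^T).

Definition train_mx T m2 n (xhat : 'I_T -> 'I_m2 -> 'cV[R]_n) :
    'M[R]_(T * n, T * m2) :=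
  blockdiag (fun j => \matrix_(k < n, i < m2) xhat j i k 0).

Definition train_labels T m2 (yhat : 'I_T -> 'I_m2 -> R) : 'cV[R]_(T * m2) :=
  stack (fun j => \col_i yhat j i).

End Blocks.

Section Model.
Context {R : realType} {T m1 m2 n : nat}.
Implicit Types (A : 'M[R]_(T * m1, T * n)) (X : 'M[R]_(T * n, T * m2)).
Implicit Types (y : 'cV[R]_(T * m2)) (w mu : 'cV[R]_(T * n)).
Implicit Types v : (R * 'cV[R]_(T * n))%type.

Definition f_val A w : R := \sum_i ln (1 + expR (- (A *m w) i 0)).

Definition h_X X w : 'cV[R]_(T * m2) :=
  map_mx (fun t => (1 - expR (- t)) / (1 + expR (- t))) (X^T *m w).

Definition g_X X y w : 'cV[R]_(T * n) := 2^-1 *: (X *m (h_X X w - y)).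

Definition u_X X w : 'cV[R]_(T * m2) :=
  map_mx (fun t => (2 + expR (- t) + expR t)^-1) (X^T *m w).

Definition q_X X w : 'cV[R]_(T * m2) :=
  map_mx (fun t => expR (- t) * (expR (- t) - 1) / (1 + expR (- t)) ^+ 3)
    (X^T *m w).

Definition p_A A w : 'cV[R]_(T * m1) :=
  map_mx (fun t => expR t / (1 + expR t) ^+ 2) (A *m w).

Definition Diag d (b : 'cV[R]_d) : 'M[R]_d := diag_mx b^T.

Definition nabla_g X y w : 'M[R]_(T * n) := jacobian_cV (g_X X y) w.

(* The vector v = [C; w] is the pair (C, w). *)
Definition P_mx X y v : 'M[R]_(T * n) := 1%:M + v.1 *: nabla_g X y v.2.

Record KKT A X y v (lam : R) mu : Prop := {
  KKT_C : - lam + (mu^T *m g_X X y v.2) 0 0 = 0;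
  KKT_w : (T * m1)%:R^-1 *: gradient (f_val A) v.2 + P_mx X y v *m mu = 0;
  KKT_lam_ge0 : 0 <= lam;
  KKT_C_ge0 : 0 <= v.1;
  KKT_compl : lam * v.1 = 0;
  KKT_eq : v.2 + v.1 *: g_X X y v.2 = 0
}.

Definition alpha A X mu v : 'M[R]_(T * n) :=
  (T * m1)%:R^-1 *: (A^T *m Diag (p_A A v.2) *m A) +
  v.1 *: (X *m Diag (X^T *m mu) *m Diag (q_X X v.2) *m X^T).

Definition z_val A X y mu v : R :=
  let gw := g_X X y v.2 in
  let Pinv := invmx (P_mx X y v) in
  (gw^T *m Pinv *m
    (alpha A X mu v *m Pinv *m gw - 2 *: (nabla_g X y v.2 *m mu))) 0 0.

Definition iota_val A X y mu : R :=
  4^-1 * (mu^T *m X *m X^T *m X *m y) 0 0 +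
  (16 * T * m1)%:R^-1 * ((X *m y)^T *m A^T *m A *m X *m y) 0 0.

Definition NLP_feasible X y : set (R * 'cV[R]_(T * n)) :=
  [set v | 0 <= v.1 /\ v.2 + v.1 *: g_X X y v.2 = 0].

Definition NLP_objective A v : R := (T * m1)%:R^-1 * f_val A v.2.

End Model.

Section NablaG.
Context {R : realType}.

Let derive_line (V : normedModType R) (F : V -> R) (w e : V) :
  'D_e F w = 'D_1 (fun t : R => F (t *: e + w)) 0.
Proof.
rewrite /derive.
under [X in _ = lim (X @ _)]funext do
  rewrite /= addr0 scale0r add0r [_ *: (1 : R)]mulr1.
by [].
Qed.

Let is_derive_comp_line (F : R -> R) (a b dF : R) :
  is_derive a 1 F dF -> is_derive (0 : R) 1 (fun t => F (t * b + a)) (b * dF).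
Proof.
move=> dFa; have -> : (fun t => F (t * b + a)) = F \o (b \*: id + cst a).
  by apply/funext => t /=; congr F; rewrite fctE /= mulrC.
have da : is_derive ((b \*: id + cst a) (0 : R)) 1 F dF.
  by rewrite fctE /= scaler0 add0r.
apply: is_derive_eq.
by rewrite addr0 [b *: 1]mulr1 /GRing.scale /= mulrC.
Qed.

Let is_derive_tanh (a : R) :
  is_derive a 1 (fun t => (1 - expR (- t)) / (1 + expR (- t)))
    (2 * (2 + expR (- a) + expR a)^-1).
Proof.
have e0 := expR_gt0 a.
have de : is_derive a 1 (expR \o -%R) (- expR (- a)).
  apply: is_derive_eq.
  by rewrite /GRing.scale /= mulrN1.
have -> : (fun t => (1 - expR (- t)) / (1 + expR (- t))) =
    (cst 1 - (expR \o -%R)) * (fun t => ((cst 1 + (expR \o -%R)) t)^-1).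
  by [].
have nz : (cst 1 + (expR \o -%R)) a != 0 :> R.
  by rewrite fctE /= gt_eqF // ltr_wpDl // expR_gt0.
have dV := is_deriveV nz.
apply: is_derive_eq.
rewrite !fctE /= /GRing.scale /= expRN; field.
by apply/and3P; split; rewrite gt_eqF //; nra.
Qed.

Lemma nabla_gE T m2 n (X : 'M[R]_(T * n, T * m2)) y w :
  nabla_g X y w = X *m Diag (u_X X w) *m X^T.
Proof.
apply/matrixP => i k; rewrite mxE derive_line.
pose s (t : R) : R := (1 - expR (- t)) / (1 + expR (- t)).
pose F l (t : R) : R := s (t * X k l + (X^T *m w) l 0).
have -> : (fun t => g_X X y (t *: delta_mx k 0 + w) i 0) =
    2^-1 \*: (\sum_l (X i l \*: (F l - cst (y l 0)))).
  apply/funext => t; rewrite !mxE fct_sumE; congr (_ * _).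
  apply: eq_bigr => l _; rewrite /= fctE /F !mxE; congr (_ * (s _ - _)).
  under eq_bigr do rewrite !mxE mulrDr mulrCA.
  rewrite big_split /= -mulr_sumr; congr (t * _ + _).
    rewrite (bigD1 k) //= !eqxx mulr1 big1 ?addr0 // => j /negPf jk.
    by rewrite jk mulr0.
  by apply: eq_bigr => j _; rewrite mxE.
have dF l : is_derive (0 : R) 1 (F l) _ := is_derive_comp_line _ (is_derive_tanh _).
rewrite derive_val mxE /GRing.scale /= mulr_sumr; apply: eq_bigr => l _.
rewrite mul_mx_diag !mxE subr0 /GRing.scale /=.
by field.
Qed.

End NablaG.

(* Main.v *)
Require Import Defs.
From mathcomp Require Import all_boot all_order all_algebra.
From mathcomp Require Import all_classical all_reals all_analysis.
From mathcomp Require Import ring lra.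
Import Order.TTheory GRing.Theory Num.Theory.
Import numFieldNormedType.Exports.
Local Open Scope ring_scope.

(* Write phi(x) = phi(a) + phi'(a)(x - a) + rho(x)(x - a)^2 / 2 with rho -> phi''(a)
   for the scalar functions composing f and g.  For a feasible v' = (C', w')
   close to v = (C, w) the constraint then reads, exactly,
     M(v') (w' - w) = - (C' - C) g(w),   M(v') -> P(v) as v' -> v,
   so that w' - w = (C' - C) r(v') with r(v') -> - P(v)^-1 g(w).  Eliminating the
   linear term of the objective by the KKT conditions leaves
     obj(v') - obj(v) = lambda (C' - C) + Z(v') (C' - C)^2,  Z(v') -> z(mu, v) / 2,
   and C' <> C whenever v' <> v.  At C = 0 one has w = 0 and z = iota. *)

(** * Scalar second-order expansions and the derivatives behind f and g *)

Section SecondOrderExpansion.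
Context {R : realType}.
Local Open Scope classical_set_scope.

(** The Caratheodory slope [g] of [psi] at [a] gives the remainder [r] the derivative (g x - c)(x -
    a). By the mean value theorem |r x| is at most |g z - c| (x - a)^2 for some z between a and x,
    and g z tends to c. *)
Lemma second_order_expansion (phi psi : R -> R) (a c : R) :
    (forall x : R, is_derive x 1 phi (psi x)) -> is_derive a 1 psi c ->
  exists2 rho : R -> R, rho x @[x --> a] --> c &
    forall x, phi x = phi a + psi a * (x - a) + 2^-1 * rho x * (x - a) ^+ 2.
Proof.
move=> dphi /is_derive1_caratheodory[g [gE gc ga]].
pose r x := phi x - phi a - psi a * (x - a) - 2^-1 * c * (x - a) ^+ 2.
(* The expansion solved for its last coefficient. At [x = a] the quotient is 0, since inversion
   sends 0 to 0, so [rho a = c]. *)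
pose rho x := c + 2 * r x / (x - a) ^+ 2.
have ra : r a = 0 by rewrite /r !subrr expr0n /= !mulr0 !subr0.
have dr (x : R) : is_derive x 1 r ((g x - c) * (x - a)).
  have -> : r = phi - cst (phi a) - (psi a \*: (id - cst a)) -
      ((2^-1 * c) \*: ((id - cst a) * (id - cst a))) :> (R -> R).
    by apply/funext => t; rewrite /r !fctE expr2.
  apply: is_derive_eq.
  rewrite mulrBl -gE !fctE /GRing.scale /=.
  by field.
have cr : continuous r.
  by move=> x; apply: differentiable_continuous; apply/derivable1_diffP.
exists rho.
  apply/cvgrPdist_le => e e0.
  (* The tolerance for [g] is halved to absorb the factor 2 in [rho]. *)
  have e20 : 0 < e / 2 by lra.
  move/cvgrPdist_le: gc => /(_ _ e20).
  rewrite ga -!nbhs_nearE => /nbhs_ballP[d d0 dg].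
  apply/nbhs_ballP; exists d => //= x; rewrite /ball /= => xd.
  have [xa|xa] := eqVneq x a.
    by rewrite /rho xa subrr expr0n /= invr0 mulr0 addr0 subrr normr0 ltW.
  have x0 : 0 < `|x - a| by rewrite normr_gt0 subr_eq0.
  (* Mean value theorem for [r], using [r a = 0], on whichever of [a, x] and [x, a] is a segment. *)
  have [z za zx] : exists2 z, `|z - a| <= `|x - a| &
      r x = (g z - c) * (z - a) * (x - a).
    have [ax|ax] := leP a x.
      have [|z + zE] := MVT_segment ax (fun t _ => dr t).
        exact: continuous_subspaceT.
      rewrite in_itv /= => /andP[az zx]; exists z; last by rewrite -zE ra subr0.
      by rewrite !ger0_norm ?subr_ge0 // lerD2r.
    have [|z + zE] := MVT_segment (ltW ax) (fun t _ => dr t).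
      exact: continuous_subspaceT.
    rewrite in_itv /= => /andP[az zx]; exists z.
      rewrite !ler0_norm ?subr_le0 // ?lerN2 ?lerD2r //.
      exact: ltW.
    by rewrite -[LHS]opprK -[- r x]add0r -ra zE; ring.
  rewrite /rho opprD addNKr normrN normrM normfV normrX normrM ger0_norm //.
  rewrite ler_pdivrMr ?exprn_gt0 // zx !normrM.
  have {}dg : `|g z - c| <= e / 2.
    by rewrite distrC; apply: dg; rewrite /ball /= distrC (le_lt_trans za) // distrC.
  have h : `|g z - c| * `|z - a| <= e / 2 * `|x - a| by apply: ler_pM.
  have := ler_wpM2r (ltW x0) h; nra.
move=> x; rewrite /rho; have [->|xa] := eqVneq x a; last first.
  by rewrite /r; field; rewrite subr_eq0.
by rewrite subrr expr0n /= !mulr0 !addr0.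
Qed.

Lemma is_derive_expRN (a : R) : is_derive a 1 (fun t => expR (- t)) (- expR (- a)).
Proof.
have -> : (fun t : R => expR (- t)) = expR \o -%R by [].
by apply: is_derive_eq; rewrite /GRing.scale /= mulrN1.
Qed.

Lemma is_derive_softplus (a : R) :
  is_derive a 1 (fun t => ln (1 + expR (- t))) (- (1 + expR a)^-1).
Proof.
have e0 := expR_gt0 a; have de := is_derive_expRN a.
have -> : (fun t : R => ln (1 + expR (- t))) =
    @ln R \o (cst 1 + (fun t => expR (- t))) by [].
have p0 : 0 < (cst 1 + (fun t => expR (- t))) a :> R.
  by rewrite fctE /= addr_gt0 // expR_gt0.
have dl := is_derive1_ln p0.
apply: is_derive_eq.
rewrite /GRing.scale /= !fctE /= expRN; field.
by rewrite ?gt_eqF //=; nra.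
Qed.

Lemma is_derive2_softplus (a : R) :
  is_derive a 1 (fun t => - (1 + expR t)^-1) (expR a / (1 + expR a) ^+ 2).
Proof.
have e0 := expR_gt0 a.
have nz : (cst 1 + @expR R) a != 0 by rewrite fctE /= gt_eqF // addr_gt0.
have -> : (fun t : R => - (1 + expR t)^-1) =
  - (fun t => ((cst 1 + @expR R) t)^-1) by [].
have dV := is_deriveV nz.
apply: is_derive_eq.
rewrite /GRing.scale /= !fctE /=; field.
by rewrite gt_eqF // addr_gt0.
Qed.

(** The factor 1/2 of g is absorbed into the scalar function, so that its first and second
    derivatives are exactly the entries of [u_X] and [q_X]. *)
Lemma is_derive_half_tanh (a : R) :
  is_derive a 1 (fun t => 2^-1 * ((1 - expR (- t)) / (1 + expR (- t))))
    (2 + expR (- a) + expR a)^-1.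
Proof.
have e0 := expR_gt0 a; have de := is_derive_expRN a.
pose E := fun t : R => expR (- t).
have -> : (fun t => 2^-1 * ((1 - expR (- t)) / (1 + expR (- t)))) =
    2^-1 \*: ((cst 1 - E) * (fun t => ((cst 1 + E) t)^-1)).
  by [].
have nz : (cst 1 + E) a != 0 :> R.
  by rewrite fctE /= gt_eqF // addr_gt0 ?expR_gt0.
have dV := is_deriveV nz.
apply: is_derive_eq.
rewrite /E !fctE /= /GRing.scale /= expRN; field.
by rewrite ?gt_eqF //=; nra.
Qed.

Lemma is_derive2_half_tanh (a : R) :
  is_derive a 1 (fun t => (2 + expR (- t) + expR t)^-1)
    (expR (- a) * (expR (- a) - 1) / (1 + expR (- a)) ^+ 3).
Proof.
have e0 := expR_gt0 a; have de := is_derive_expRN a.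
pose E := fun t : R => expR (- t).
have -> : (fun t : R => (2 + expR (- t) + expR t)^-1) =
  (fun t => ((cst 2 + E + @expR R) t)^-1) by [].
have nz : (cst 2 + E + @expR R) a != 0 :> R.
  by rewrite fctE /= gt_eqF // !addr_gt0 ?expR_gt0.
have dV := is_deriveV nz.
apply: is_derive_eq.
rewrite /E !fctE /= /GRing.scale /= expRN; field.
by rewrite ?gt_eqF //=; nra.
Qed.

End SecondOrderExpansion.

(** * Limits of matrices, entry by entry along an arbitrary filter *)

Section EntrywiseLimits.
Context {R : realType} {V : Type} {F : set_system V} {FF : Filter F}.
Local Open Scope classical_set_scope.

Lemma cvg_sum_fin (I : finType) (f : I -> V -> R) (l : I -> R) :
  (forall i, f i x @[x --> F] --> l i) ->
  \sum_i f i x @[x --> F] --> \sum_i l i.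
Proof. by move=> fl; apply: cvg_big => // x; exact: add_continuous. Qed.

Lemma cvg_mulmx m n p (f : V -> 'M[R]_(m, n)) (g : V -> 'M[R]_(n, p))
    (a : 'M[R]_(m, n)) (b : 'M[R]_(n, p)) :
  (forall i j, f x i j @[x --> F] --> a i j) ->
  (forall i j, g x i j @[x --> F] --> b i j) ->
  forall i j, (f x *m g x) i j @[x --> F] --> (a *m b) i j.
Proof.
move=> fa gb i j; rewrite mxE.
under eq_cvg do rewrite mxE.
by apply: cvg_sum_fin => k; exact: cvgM.
Qed.

Lemma cvg_addmx m n (f g : V -> 'M[R]_(m, n)) (a b : 'M[R]_(m, n)) :
  (forall i j, f x i j @[x --> F] --> a i j) ->
  (forall i j, g x i j @[x --> F] --> b i j) ->
  forall i j, (f x + g x) i j @[x --> F] --> (a + b) i j.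
Proof.
move=> fa gb i j; rewrite mxE.
under eq_cvg do rewrite mxE.
exact: cvgD.
Qed.

Lemma cvg_scalemx m n (c : V -> R) (f : V -> 'M[R]_(m, n))
    (d : R) (a : 'M[R]_(m, n)) :
  c x @[x --> F] --> d ->
  (forall i j, f x i j @[x --> F] --> a i j) ->
  forall i j, (c x *: f x) i j @[x --> F] --> (d *: a) i j.
Proof.
move=> cd fa i j; rewrite mxE.
under eq_cvg do rewrite mxE.
exact: cvgM.
Qed.

Lemma cvg_trmx m n (f : V -> 'M[R]_(m, n)) (a : 'M[R]_(m, n)) :
  (forall i j, f x i j @[x --> F] --> a i j) ->
  forall i j, (f x)^T i j @[x --> F] --> a^T i j.
Proof. by move=> fa i j; rewrite mxE; under eq_cvg do rewrite mxE; exact: fa. Qed.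

Lemma cvg_Diag d (f : V -> 'cV[R]_d) (a : 'cV[R]_d) :
  (forall i j, f x i j @[x --> F] --> a i j) ->
  forall i j, Diag (f x) i j @[x --> F] --> Diag a i j.
Proof.
move=> fa i j; rewrite /Diag !mxE.
under eq_cvg do rewrite !mxE.
case: (i == j); first by rewrite mulr1n; exact: fa.
by rewrite mulr0n; exact: cvg_cst.
Qed.

(** By the Leibniz formula the determinant is a finite sum of finite products of entries. *)
Lemma cvg_det d (f : V -> 'M[R]_d) (a : 'M[R]_d) :
  (forall i j, f x i j @[x --> F] --> a i j) ->
  \det (f x) @[x --> F] --> \det a.
Proof.
move=> fa; apply: cvg_sum_fin => s; apply: cvgM; first exact: cvg_cst.
apply: cvg_big => [x|i _]; last exact: fa.
exact: mul_continuous.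
Qed.

Lemma near_unitmx d (f : V -> 'M[R]_d) (a : 'M[R]_d) :
  (forall i j, f x i j @[x --> F] --> a i j) -> a \in unitmx ->
  \forall x \near F, f x \in unitmx.
Proof.
move=> /cvg_det fa; rewrite unitmxE unitfE => a0.
apply: filterS (cvgr_neq0 _ fa a0) => x.
by rewrite unitmxE unitfE.
Qed.

Lemma cvg_invmx d (f : V -> 'M[R]_d) (a : 'M[R]_d) :
  (forall i j, f x i j @[x --> F] --> a i j) -> a \in unitmx ->
  forall i j, invmx (f x) i j @[x --> F] --> invmx a i j.
Proof.
move=> fa au i j; rewrite /invmx au.
(* [invmx] is the adjugate over the determinant on invertible matrices and the identity map
   elsewhere. As [f x] is eventually invertible, the cofactor formula may replace it under the
   limit. *)
apply: (@cvg_trans _ ((((\det (f x))^-1 *: \adj (f x)) i j) @[x --> F])).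
  apply: near_eq_cvg; near=> x.
  have -> : f x \in unitmx by near: x; exact: near_unitmx fa au.
  by [].
apply: cvg_scalemx.
  by apply: cvgV; [rewrite -unitfE -unitmxE | exact: cvg_det].
move=> k l; rewrite mxE; under eq_cvg do rewrite mxE.
apply: cvgM; first exact: cvg_cst.
apply: cvg_det => i' j'; rewrite !mxE; under eq_cvg do rewrite !mxE.
exact: fa.
Unshelve. all: by end_near. Qed.

End EntrywiseLimits.

(** * Exact expansions of f and g, and invertibility of P *)

Section ModelExpansions.
Context {R : realType} {T m1 m2 n : nat}.
Local Open Scope classical_set_scope.
Implicit Types (A : 'M[R]_(T * m1, T * n)) (X : 'M[R]_(T * n, T * m2)).
Implicit Types (y : 'cV[R]_(T * m2)) (w mu : 'cV[R]_(T * n)).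
Implicit Types v : (R * 'cV[R]_(T * n))%type.

Lemma gradient_f_valE A w :
  gradient (f_val A) w = A^T *m map_mx (fun t => - (1 + expR t)^-1) (A *m w).
Proof.
apply/matrixP => k j; rewrite !mxE ord1 {j}.
(* The i-th summand of f on the line w + t e_k: softplus composed with an affine function of slope
   [A i k]. *)
pose F i (t : R) : R := ln (1 + expR (- (t * A i k + (A *m w) i 0))).
have -> : 'D_(delta_mx k 0) (f_val A) w = 'D_1 (\sum_i F i) (0 : R).
  rewrite /derive.
  suff E t : (f_val A \o shift w) (t *: delta_mx k 0) = (\sum_i F i) t.
    apply: (congr1 (fun G : R -> R => lim (G @ 0^'))); apply/funext => h.
    rewrite E /= addr0 [h *: 1]mulr1.
    by rewrite -(E 0) /= scale0r add0r.
  rewrite fct_sumE; apply: eq_bigr => i _; rewrite /F /= !mulmxDr.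
  by rewrite mxE -scalemxAr -colE !mxE.
have dF i : is_derive (0 : R) 1 (F i) (- (1 + expR ((A *m w) i 0))^-1 * A i k).
  pose l : R -> R := A i k \*: id + cst ((A *m w) i 0).
  have l0 : l 0 = (A *m w) i 0 by rewrite /l !fctE /= scaler0 add0r.
  have -> : F i = (fun t => ln (1 + expR (- t))) \o l.
    by apply/funext => t; rewrite /F /l /= !fctE /= /GRing.scale /= [t * _]mulrC.
  have dl : is_derive (0 : R) 1 l (A i k).
    by apply: is_derive_eq; rewrite addr0 [_ *: _]mulr1.
  rewrite -l0; apply: is_derive1_comp; exact: is_derive_softplus.
rewrite derive_val; apply: eq_bigr => i _.
by rewrite !mxE mulrC.
Qed.

(** The sum is symmetric in the four vectors, which the matrix product hides; this lets the
    multiplier and the displacement trade places. *)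
Lemma quad_DiagE d (a b c e : 'cV[R]_d) :
  (a^T *m Diag b *m Diag c *m e) 0 0 = \sum_i a i 0 * b i 0 * c i 0 * e i 0.
Proof.
rewrite mxE; apply: eq_bigr => i _.
by rewrite /Diag !mul_mx_diag !mxE.
Qed.

Lemma quad_Diag1E d (a b e : 'cV[R]_d) :
  (a^T *m Diag b *m e) 0 0 = \sum_i a i 0 * b i 0 * e i 0.
Proof.
by rewrite mxE; apply: eq_bigr => i _; rewrite /Diag !mul_mx_diag !mxE.
Qed.

Lemma cvg_mulmx_coord p q (B : 'M[R]_(p, q)) (w : 'cV[R]_q) i :
  (B *m x) i 0 @[x --> w] --> (B *m w) i 0.
Proof.
by apply: (@cvg_mulmx _ _ (nbhs w)) => k l; [exact: cvg_cst | exact: coord_continuous].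
Qed.

(** The scalar expansion is applied in each component of A x around the matching component of A w;
    [tau] collects the scalar coefficients [rho], whose limits are the entries of [p_A]. *)
Lemma f_val_expansion A w :
  exists2 tau : 'cV[R]_(T * n) -> 'cV[R]_(T * m1),
    (forall i j, tau x i j @[x --> w] --> p_A A w i j) &
    forall x, f_val A x = f_val A w + ((gradient (f_val A) w)^T *m (x - w)) 0 0 +
      2^-1 * ((x - w)^T *m (A^T *m Diag (tau x) *m A) *m (x - w)) 0 0.
Proof.
have /choice[rho rhoP] : forall i, exists rho : R -> R,
    (rho t @[t --> (A *m w) i 0] --> p_A A w i 0) /\
    forall t, ln (1 + expR (- t)) = ln (1 + expR (- (A *m w) i 0)) -
      (1 + expR ((A *m w) i 0))^-1 * (t - (A *m w) i 0) +
      2^-1 * rho t * (t - (A *m w) i 0) ^+ 2.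
  move=> i.
  have [rho rho_cvg rhoE] := second_order_expansion _ _ _ _ is_derive_softplus
    (is_derive2_softplus ((A *m w) i 0)).
  by exists rho; split=> [|t]; [rewrite [p_A _ _ _ _]mxE | rewrite rhoE mulNr].
exists (fun x => \col_i rho i ((A *m x) i 0)) => [i j|x].
  rewrite ord1 {j}; under eq_cvg do rewrite mxE.
  have [+ _] := rhoP i; apply: cvg_comp; exact: cvg_mulmx_coord.
have -> (S : 'M[R]_(T * m1)) : (x - w)^T *m (A^T *m S *m A) *m (x - w) =
    (A *m (x - w))^T *m S *m (A *m (x - w)) by rewrite trmx_mul !mulmxA.
rewrite quad_Diag1E gradient_f_valE trmx_mul trmxK -mulmxA mxE mulr_sumr.
rewrite -!big_split /=; apply: eq_bigr => i _.
have [_ ->] := rhoP i; rewrite mulmxBr !mxE; ring.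
Qed.

(** Componentwise as for f. The square of X^T (x - w) is written as a diagonal matrix acting on that
    vector, so the remainder is a matrix applied to x - w and can join a linear system for x - w. *)
Lemma g_X_expansion X y w :
  exists2 kappa : 'cV[R]_(T * n) -> 'cV[R]_(T * m2),
    (forall i j, kappa x i j @[x --> w] --> q_X X w i j) &
    forall x, g_X X y x = g_X X y w + nabla_g X y w *m (x - w) +
      2^-1 *: (X *m Diag (kappa x) *m Diag (X^T *m (x - w)) *m X^T *m (x - w)).
Proof.
have /choice[rho rhoP] : forall i, exists rho : R -> R,
    (rho t @[t --> (X^T *m w) i 0] --> q_X X w i 0) /\
    forall t, 2^-1 * ((1 - expR (- t)) / (1 + expR (- t))) =
      2^-1 * h_X X w i 0 + u_X X w i 0 * (t - (X^T *m w) i 0) +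
      2^-1 * rho t * (t - (X^T *m w) i 0) ^+ 2.
  move=> i.
  have [rho rho_cvg rhoE] := second_order_expansion _ _ _ _ is_derive_half_tanh
    (is_derive2_half_tanh ((X^T *m w) i 0)).
  by exists rho; split=> [|t]; [rewrite [q_X _ _ _ _]mxE | rewrite rhoE !mxE].
exists (fun x => \col_i rho i ((X^T *m x) i 0)) => [i j|x].
  rewrite ord1 {j}; under eq_cvg do rewrite mxE.
  have [+ _] := rhoP i; apply: cvg_comp; exact: cvg_mulmx_coord.
rewrite nabla_gE /g_X -!mulmxA !(scalemxAr _ X) -!mulmxDr; congr (X *m _).
apply/matrixP => i j; rewrite ord1 {j}.
have [_ /(_ ((X^T *m x) i 0)) E] := rhoP i.
have hE : h_X X x i 0 = (1 - expR (- (X^T *m x) i 0)) / (1 + expR (- (X^T *m x) i 0)).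
  by rewrite mxE.
rewrite /Diag !mul_diag_mx.
rewrite [LHS]mxE [(h_X X x - y) i 0]mxE hE mulrDr E mulmxBr /h_X /u_X.
by move: (X^T *m x) (X^T *m w) => b a; rewrite !mxE; ring.
Qed.

Lemma nabla_g_sym X y w : (nabla_g X y w)^T = nabla_g X y w.
Proof. by rewrite nabla_gE !trmx_mul trmxK /Diag tr_diag_mx mulmxA. Qed.

Lemma P_mx_sym X y v : (P_mx X y v)^T = P_mx X y v.
Proof. by rewrite /P_mx linearD linearZ /= trmx1 nabla_g_sym. Qed.

(** A row x with x P = 0 gives 0 = x P x^T = |x|^2 + C sum_k u_k (X^T x^T)_k^2. Both terms are
    nonnegative, so |x|^2 = 0. *)
Lemma P_mx_unit X y v : 0 <= v.1 -> P_mx X y v \in unitmx.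
Proof.
move=> C0; rewrite -row_free_unit -kermx_eq0; apply/eqP/row_matrixP => i.
rewrite row0; set x := row i _.
have xP : x *m P_mx X y v = 0 by apply/sub_kermxP; exact: row_sub.
clearbody x.
have : (x *m P_mx X y v *m x^T) 0 0 = 0 by rewrite xP mul0mx mxE.
rewrite /P_mx mulmxDr mulmxDl mulmx1 mxE -scalemxAr -scalemxAl nabla_gE.
have -> : x *m (X *m Diag (u_X X v.2) *m X^T) *m x^T =
    ((X^T *m x^T)^T *m Diag (u_X X v.2) *m (X^T *m x^T)).
  by rewrite trmx_mul !trmxK !mulmxA.
rewrite [X in _ + X]mxE quad_Diag1E.
have s0 : 0 <= \sum_k (X^T *m x^T) k 0 * u_X X v.2 k 0 * (X^T *m x^T) k 0.
  apply: sumr_ge0 => k _; rewrite mulrAC mulr_ge0 //; first by rewrite -expr2 sqr_ge0.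
  by rewrite mxE invr_ge0 !addr_ge0 // expR_ge0.
have x0 : 0 <= (x *m x^T) 0 0.
  by rewrite mxE; apply: sumr_ge0 => k _; rewrite mxE -expr2 sqr_ge0.
move=> /eqP; rewrite paddr_eq0 ?mulr_ge0 // => /andP[+ _].
rewrite mxE psumr_eq0 => [/allP z0|k _]; last by rewrite mxE -expr2 sqr_ge0.
apply/matrixP => j k; rewrite ord1 {j}.
have := z0 k (mem_index_enum _); rewrite mxE -expr2 sqrf_eq0 /= => /eqP ->.
by rewrite mxE.
Qed.

End ModelExpansions.

(** * Reduction of the objective to the single variable C *)

Section SecondOrderReduction.
Context {R : realType} {T m1 m2 n : nat}.
Local Open Scope classical_set_scope.
Implicit Types (A : 'M[R]_(T * m1, T * n)) (X : 'M[R]_(T * n, T * m2)).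
Implicit Types (y : 'cV[R]_(T * m2)) (w mu : 'cV[R]_(T * n)).
Implicit Types v : (R * 'cV[R]_(T * n))%type.

Lemma quad_scale d (c : R) (B : 'M[R]_d) (x : 'cV[R]_d) :
  ((c *: x)^T *m B *m (c *: x)) 0 0 = c ^+ 2 * (x^T *m B *m x) 0 0.
Proof.
by rewrite [(c *: x)^T]linearZ /= -!scalemxAl -scalemxAr scalerA mxE -expr2.
Qed.

Lemma dot_scale d (c : R) (x u : 'cV[R]_d) :
  ((c *: x)^T *m u) 0 0 = c * (x^T *m u) 0 0.
Proof. by rewrite [(c *: x)^T]linearZ /= -scalemxAl mxE. Qed.

Lemma feasible_expansion A X y C w lam mu :
  KKT A X y (C, w) lam mu ->
  exists2 Z : R * 'cV[R]_(T * n) -> R,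
    Z v @[v --> (C, w)] --> 2^-1 * z_val A X y mu (C, w) &
    \forall v \near (C, w), NLP_feasible X y v ->
      (v.1 = C -> v = (C, w)) /\
      NLP_objective A v = NLP_objective A (C, w) + lam * (v.1 - C) +
        Z v * (v.1 - C) ^+ 2.
Proof.
move=> [/= kC kw _ C0 _ keq].
have [tau tau_cvg fE] := f_val_expansion A w.
have [kappa kappa_cvg gE] := g_X_expansion X y w.
have Psym := P_mx_sym X y (C, w).
have PU : P_mx X y (C, w) \in unitmx by exact: P_mx_unit.
have Gsym := nabla_g_sym X y w.
pose N : R := (T * m1)%:R^-1.
set G := nabla_g X y w in gE Gsym *; set g := g_X X y w in kC keq gE *.
set P := P_mx X y (C, w) in kw Psym PU *.
(* [G + 2^-1 *: Q v] is a secant matrix of g between w and [v.2], [M v] is the secant counterpart of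
   P, and [r v] is the displacement of w per unit of C. [S v] is [Q v] with [mu] in place of the
   displacement, and [al v] tends to [alpha]. *)
pose Q v := X *m Diag (kappa v.2) *m Diag (X^T *m (v.2 - w)) *m X^T.
pose M v := 1%:M + v.1 *: (G + 2^-1 *: Q v).
pose r v := invmx (M v) *m (- g).
pose S v := X *m Diag (X^T *m mu) *m Diag (kappa v.2) *m X^T.
pose al v := N *: (A^T *m Diag (tau v.2) *m A) + v.1 *: S v.
pose Z v := 2^-1 * ((r v)^T *m al v *m r v) 0 0 + ((r v)^T *m (G *m mu)) 0 0.
have c1 : v.1 @[v --> (C, w)] --> C by exact: cvg_fst.
have c2 : v.2 @[v --> (C, w)] --> w by exact: cvg_snd.
have cst_cvg p q (B : 'M[R]_(p, q)) i j :
  (fun=> B i j) v @[v --> (C, w)] --> B i j by exact: cvg_cst.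
have cw i j : (v.2 : 'cV[R]_(T * n)) i j @[v --> (C, w)] --> w i j.
  exact: (cvg_comp _ _ c2 (@coord_continuous _ _ _ _ _ _)).
have ctau i j : tau v.2 i j @[v --> (C, w)] --> p_A A w i j.
  exact: (cvg_comp _ _ c2 (tau_cvg i j)).
have ckappa i j : kappa v.2 i j @[v --> (C, w)] --> q_X X w i j.
  exact: (cvg_comp _ _ c2 (kappa_cvg i j)).
have cM i j : M v i j @[v --> (C, w)] --> P i j.
  (* At the base point the displacement vanishes, hence so does the [Q] term. *)
  have -> : P = 1%:M + C *: (G + 2^-1 *: (X *m Diag (q_X X w) *m
      Diag (X^T *m (w - w)) *m X^T)).
    by rewrite subrr mulmx0 {2}/Diag trmx0 linear0 mulmx0 mul0mx scaler0 addr0.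
  apply: cvg_addmx => {i j} // i j; apply: cvg_scalemx => // {i j} i j.
  apply: cvg_addmx => {i j} // i j; apply: cvg_scalemx => {i j} [|i j].
    exact: cvg_cst.
  apply: cvg_mulmx => {i j} // i j; apply: cvg_mulmx => {i j} i j.
    by apply: cvg_mulmx => {i j} // i j; exact: cvg_Diag.
  apply: cvg_Diag => {i j} i j; apply: cvg_mulmx => {i j} // i j.
  exact: cvg_addmx.
have cr i j : r v i j @[v --> (C, w)] --> (invmx P *m - g) i j.
  by apply: cvg_mulmx => {i j} // i j; exact: cvg_invmx.
have cal i j : al v i j @[v --> (C, w)] --> alpha A X mu (C, w) i j.
  apply: cvg_addmx => {i j} i j; apply: cvg_scalemx => {i j} //.
  - exact: cvg_cst.
  - move=> i j; apply: cvg_mulmx => {i j} // i j.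
    by apply: cvg_mulmx => {i j} // i j; exact: cvg_Diag.
  - move=> i j; apply: cvg_mulmx => {i j} // i j.
    by apply: cvg_mulmx => {i j} // i j; exact: cvg_Diag.
exists Z.
  (* Since [r v] tends to - P^-1 g, the sign cancels in the quadratic term and yields the minus sign
     of the gradient term of z; symmetry of P transposes its inverse. *)
  have -> : 2^-1 * z_val A X y mu (C, w) =
      2^-1 * ((invmx P *m - g)^T *m alpha A X mu (C, w) *m (invmx P *m - g)) 0 0 +
      ((invmx P *m - g)^T *m (G *m mu)) 0 0.
    rewrite /z_val /= -/G -/g -/P; clearbody g.
    rewrite !mulmxN linearN /= trmx_mul trmx_inv Psym !mulNmx opprK mulmxBr.
    rewrite -scalemxAr !mulmxA.
    by move: (_ *m mu) (_ *m g) => a b; rewrite !mxE; field.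
  apply: cvgD; last first.
    by apply: cvg_mulmx => // i j; exact: cvg_trmx.
  apply: cvgM; first exact: cvg_cst.
  apply: cvg_mulmx => // i j.
  by apply: cvg_mulmx => // {i j} i j; exact: cvg_trmx.
near=> v; move=> [v0 vE].
have MU : M v \in unitmx by near: v; exact: (near_unitmx _ _ _ cM PU).
(* The difference of the two equality constraints, with g at [v.2] expanded around w. *)
have dE : M v *m (v.2 - w) = (v.1 - C) *: - g.
  have -> : M v *m (v.2 - w) = (v.2 - w) + v.1 *: (g_X X y v.2 - g).
    rewrite gE /M mulmxDl mul1mx -scalemxAl mulmxDl -scalemxAl /Q.
    by congr (_ + _ *: _); rewrite [g + _]addrC addrAC addrK.
  move: (g_X X y v.2) vE => gv vE; clearbody g.
  have -> : v.2 = - (v.1 *: gv) by apply/eqP; rewrite -addr_eq0 vE.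
  have -> : w = - (C *: g) by apply/eqP; rewrite -addr_eq0 keq.
  by apply/matrixP => i j; rewrite !mxE; ring.
have dwE : v.2 - w = (v.1 - C) *: r v.
  by rewrite /r scalemxAr -dE mulKmx.
split=> [vC|].
  rewrite [v]surjective_pairing vC; congr (_, _).
  by apply/eqP; rewrite -subr_eq0 dwE vC subrr scale0r.
(* P = M v - (v.1 - C) G - (v.1 / 2) Q v. *)
have PE : P *m (v.2 - w) = (v.1 - C) *: - g - (v.1 - C) *: (G *m (v.2 - w)) -
    (2^-1 * v.1) *: (Q v *m (v.2 - w)).
  rewrite -dE /M /P /P_mx /= -/G !mulmxDl !mul1mx -!scalemxAl mulmxDl -scalemxAl.
  by apply/matrixP => i j; rewrite !mxE; ring.
have QS : (mu^T *m (Q v *m (v.2 - w))) 0 0 = ((v.2 - w)^T *m S v *m (v.2 - w)) 0 0.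
  have -> : mu^T *m (Q v *m (v.2 - w)) = (X^T *m mu)^T *m Diag (kappa v.2) *m
      Diag (X^T *m (v.2 - w)) *m (X^T *m (v.2 - w)).
    by rewrite trmx_mul trmxK /Q !mulmxA.
  have -> : (v.2 - w)^T *m S v *m (v.2 - w) = (X^T *m (v.2 - w))^T *m
      Diag (X^T *m mu) *m Diag (kappa v.2) *m (X^T *m (v.2 - w)).
    by rewrite trmx_mul trmxK /S !mulmxA.
  by rewrite !quad_DiagE; apply: eq_bigr => i _; ring.
have GE : (mu^T *m (G *m (v.2 - w))) 0 0 = ((v.2 - w)^T *m (G *m mu)) 0 0.
  have -> : (v.2 - w)^T *m (G *m mu) = (mu^T *m (G *m (v.2 - w)))^T.
    by rewrite !trmx_mul trmxK Gsym mulmxA.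
  by rewrite [RHS]mxE.
(* Stationarity in w turns the linear term of the objective into the multiplier tested against P
   (v.2 - w), which [PE] evaluates. *)
have fwE : N * ((gradient (f_val A) w)^T *m (v.2 - w)) 0 0 =
    - (mu^T *m (P *m (v.2 - w))) 0 0.
  have {}kw : N *: gradient (f_val A) w = - (P *m mu).
    by apply/eqP; rewrite -addr_eq0 kw.
  have -> : N * ((gradient (f_val A) w)^T *m (v.2 - w)) 0 0 =
      ((N *: gradient (f_val A) w)^T *m (v.2 - w)) 0 0.
    by rewrite linearZ /= -scalemxAl [RHS]mxE.
  by rewrite kw linearN /= mulNmx trmx_mul Psym -mulmxA [LHS]mxE.
have lamE : (mu^T *m g) 0 0 = lam by apply/eqP; rewrite -subr_eq0 addrC kC.
clearbody g G.
rewrite /NLP_objective -/N fE !mulrDr fwE PE /=.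
have -> : (mu^T *m ((v.1 - C) *: - g - (v.1 - C) *: (G *m (v.2 - w)) -
    (2^-1 * v.1) *: (Q v *m (v.2 - w)))) 0 0 =
    - (v.1 - C) * lam - (v.1 - C) * ((v.2 - w)^T *m (G *m mu)) 0 0 -
    2^-1 * v.1 * ((v.2 - w)^T *m S v *m (v.2 - w)) 0 0.
  rewrite -lamE -GE -QS.
  move: (v.2 - w) (Q v) => dw Qv; rewrite !mulmxBr -!scalemxAr mulmxN.
  move: (mu^T *m g) (mu^T *m (G *m dw)) (mu^T *m (Qv *m dw)) => a b c.
  by rewrite !mxE; ring.
(* Each displacement contributes a factor [v.1 - C], so every term except the one in [lam] becomes
   quadratic. *)
rewrite dwE !quad_scale dot_scale.
have -> : Z v = 2^-1 * (N * ((r v)^T *m (A^T *m Diag (tau v.2) *m A) *m r v) 0 0 +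
    v.1 * ((r v)^T *m S v *m r v) 0 0) + ((r v)^T *m (G *m mu)) 0 0.
  rewrite /Z /al mulmxDr mulmxDl -!scalemxAr -!scalemxAl.
  by move: (_ *m r v) (_ *m r v) => a b; rewrite !mxE.
ring.
Unshelve. all: by end_near. Qed.

(** At the origin h vanishes, u and p are constantly 1/4, P is the identity and the second part of
    [alpha] drops out. *)
Lemma z_val0 A X y mu : z_val A X y mu (0, 0) = iota_val A X y mu.
Proof.
have sg : g_X X y 0 = - 2^-1 *: (X *m y).
  rewrite /g_X scaleNr -scalerN -mulmxN; congr (_ *: (_ *m _)).
  apply/matrixP => i j; rewrite /h_X mulmx0 !mxE oppr0 expR0 subrr mul0r.
  by rewrite sub0r.
have sG : nabla_g X y 0 = 4^-1 *: (X *m X^T).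
  rewrite nabla_gE; have -> : Diag (u_X X 0) = 4^-1%:M.
    apply/matrixP => i j; rewrite /Diag /u_X mulmx0 !mxE oppr0 expR0.
    by congr (_^-1 *+ _); ring.
  by rewrite mul_mx_scalar -scalemxAl.
have sp : Diag (p_A A 0) = 4^-1%:M :> 'M[R]_(T * m1).
  apply/matrixP => i j; rewrite /Diag /p_A mulmx0 !mxE expR0.
  by congr (_ *+ _); field.
rewrite /z_val /alpha /P_mx /= !scale0r !addr0 invmx1 !mulmx1 sg sG sp.
rewrite dot_scale scaleNr !mulmxN mulmxBr.
have Nmu : ((X *m y)^T *m (X *m X^T *m mu)) 0 0 =
    (mu^T *m X *m X^T *m X *m y) 0 0.
  have -> : mu^T *m X *m X^T *m X *m y = ((X *m y)^T *m (X *m X^T *m mu))^T.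
    by rewrite !trmx_mul !trmxK !mulmxA.
  by rewrite [RHS]mxE.
rewrite /iota_val -Nmu.
have -> : (X *m y)^T *m A^T *m A *m X *m y =
    (X *m y)^T *m (A^T *m A *m (X *m y)) by rewrite !mulmxA.
rewrite mul_mx_scalar; move: (X *m y) (X *m X^T) => x B.
rewrite -!scalemxAl mulmxN -!scalemxAr.
move: (x^T *m _) (x^T *m _) => a b; rewrite !mxE -mulnA (natrM _ 16) (invfM 16).
by move: ((T * m1)%:R^-1) => N; field.
Qed.

End SecondOrderReduction.

(** * The three sufficient conditions *)

Theorem theorem3p5 (R : realType) (T m1 m2 n : nat)
  (T_gt0 : (0 < T)%N) (m1_gt0 : (0 < m1)%N)
  (m2_gt0 : (0 < m2)%N) (n_gt0 : (0 < n)%N)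
  (xbar : 'I_T -> 'I_m1 -> 'cV[R]_n) (ybar : 'I_T -> 'I_m1 -> R)
  (xhat : 'I_T -> 'I_m2 -> 'cV[R]_n) (yhat : 'I_T -> 'I_m2 -> R)
  (ybar_pm1 : forall j i, ybar j i = 1 \/ ybar j i = -1)
  (yhat_pm1 : forall j i, yhat j i = 1 \/ yhat j i = -1)
  (C lam : R) (w mu : 'cV[R]_(T * n)) :
  let A := val_mx xbar ybar in
  let X := train_mx xhat in
  let y := train_labels yhat in
  let v := (C, w) in
  KKT A X y v lam mu ->
  [\/ 0 < C /\ 0 < z_val A X y mu v,
      [/\ C = 0, lam = 0 & 0 < iota_val A X y mu]
    | C = 0 /\ 0 < lam] ->
  strict_local_minimizer (NLP_feasible X y) (NLP_objective A) v.
Proof.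
move=> A X y v kkt hyp.
have [Z Zcvg Zexp] := feasible_expansion _ _ _ _ _ _ _ kkt.
have [/= _ _ _ C0 compl keq] := kkt.
split; first by split.
(* Shared by (i), where complementarity forces [lam = 0], and (ii), where the constraint at C = 0
   gives w = 0 and z equals iota. *)
have second_order : lam = 0 -> 0 < z_val A X y mu v ->
    \forall v' \near v, NLP_feasible X y v' -> v' <> v ->
      NLP_objective A v < NLP_objective A v'.
  move=> lam0 z0.
  have Z0 : \forall v' \near v, 0 < Z v'.
    by apply: (cvgr_gt _ Zcvg); rewrite mulr_gt0 // invr_gt0.
  near=> v' => feas neq.
  have [||eqC ->] := near Zexp v'; rewrite ?lam0 ?mul0r ?addr0 ?ltrDl //.
  rewrite mulr_gt0 //; first by near: v'.
  by rewrite exprn_even_gt0 //= subr_eq0; apply/eqP => /eqC.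
case: hyp => [[Cpos z0]|[C0' lam0 iota0]|[C0' lam0]].
- by apply: second_order => //; apply/eqP; move/eqP: compl;
    rewrite mulf_eq0 (gt_eqF Cpos) orbF.
- apply: second_order => //.
  have w0 : w = 0 by move: keq; rewrite C0' scale0r addr0.
  by rewrite /v C0' w0 z_val0.
- have c1 : (v'.1 @[v' --> v] --> C)%classic by exact: cvg_fst.
  (* In case (iii) the increase of the objective is this factor times [v'.1 - C]. The factor tends
     to [lam], and at C = 0 the other one is nonnegative by feasibility and nonzero when v' differs
     from v. *)
  have slope : \forall v' \near v, 0 < lam + Z v' * (v'.1 - C).
    apply: (@cvgr_gt _ _ (nbhs v) _ _ (lam + 2^-1 * z_val A X y mu v * (C - C))).
      apply: cvgD; first exact: cvg_cst.
      apply: cvgM => //; apply: cvgB => //; exact: cvg_cst.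
    by rewrite subrr mulr0 addr0.
  near=> v' => feas neq.
  have [||eqC ->] := near Zexp v'; rewrite // -addrA ltrDl expr2 mulrA -mulrDl.
  rewrite mulr_gt0 //; first by near: v'.
  case: (feas) => v'0 _; rewrite C0' subr0 lt_neqAle v'0 andbT eq_sym.
  by apply/eqP => /= v'C; apply: neq; rewrite eqC // C0'.
Unshelve. all: by end_near. Qed.
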